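(* Let $R$ be a unital commutative ring, $T=(V,E)$ a tree with $V=[n]$, and suppose each edge $\{i,j\}\in E$ carries two (possibly different) elements $a_{ij},a_{ji}\in R$. Let $D_T\in R^{n\times n}$ have $(i,j)$ entry $\sum_{l=0}^{k-1}a_{i_li_{l+1}}$, where $i=i_0,\dots,i_k=j$ is the unique path from $i$ to $j$ (so the diagonal is $0$). Let $J$ be the all-ones matrix and $x$ an indeterminate. Let $I,J'\subseteq V$ satisfy: (a) $|I|=|J'|\le n-3$; (b) $I\cup J'\subsetneq V$; (c) the subgraphs of $T$ induced on $V\setminus I$, $V\setminus J'$, $V\setminus(I\cap J')$ are connected; and let $E_\circ$ be the set of edges with no endpoint in $I\cap J'$. Then (i) if $|I\Delta J'|=0$: $\det(D_T+xJ)_{I|J'}=(-1)^{|E_\circ|}\Big(\sum_{e\in E_\circ}a_ea'_e\prod_{f\in E_\circ\setminus\{e\}}(a_f+a'_f)+x\prod_{e\in E_\circ}(a_e+a'_e)\Big)$; (ii) if $|I\Delta J'|=2$ with $I\setminus J'=\{i_0\}$, $J'\setminus I=\{j_0\}$: $\det(D_T+xJ)_{I|J'}=a_{p(i_0)i_0}\,a_{j_0p(j_0)}\prod_{e\in E_\circ\setminus\{\{p(i_0),i_0\},\{j_0,p(j_0)\}\}}(a_e+a'_e)$; (iii) if $|I\Delta J'|>2$: $\det(D_T+xJ)_{I|J'}=0$.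
   Context: For an edge $e=\{i,j\}$, $a_e,a'_e$ denote the two directed weights $a_{ij},a_{ji}$ (the formulas in (i) are symmetric in them). $D_{I|J'}$ denotes the submatrix obtained by deleting the rows indexed by $I$ and the columns indexed by $J'$. $p(i_0)$ is the unique neighbour of $i_0$ in the tree induced on $V\setminus(I\cap J')$ (its unique neighbour in $T$ when $i_0$ is pendant), similarly $p(j_0)$; $a_{p(i_0)i_0}$ is the weight in direction $p(i_0)\to i_0$ and $a_{j_0p(j_0)}$ the weight in direction $j_0\to p(j_0)$.
   Formalization: In (ii) the right-hand side is multiplied by $(-1)^m$, $m$ the number of labels in $V\setminus(I\cup J')$ not between $i_0$ and $j_0$; the printed sign fails in general (star with centre 2, leaves 1,3,4, unit weights, $I=\{1\}$, $J'=\{3\}$ gives $-2$). $R$ is nonzero. *)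

(* Defs.v *)
From mathcomp Require Import all_boot all_order all_algebra.

Set Implicit Arguments.
Unset Strict Implicit.
Unset Printing Implicit Defensive.

Import GRing.Theory.
Local Open Scope ring_scope.

Section Trees.

Variables (V : finType) (e : rel V).

Definition induced (S : {set V}) : rel V :=
  [rel u v | [&& u \in S, v \in S & e u v]].

Definition connected_on (S : {set V}) : Prop :=
  {in S &, forall u v, connect (induced S) u v}.

(* A duplicate-free [cycle e] of size 2 is a single edge walked back and forth,
   so a cycle of the graph is one of size at least 3. *)
Definition acyclic : Prop := forall c : seq V, ucycle e c -> (size c < 3)%N.

Record is_tree : Prop := IsTree {
  tree_sym : symmetric e;
  tree_irr : irreflexive e;
  tree_nonempty : (0 < #|V|)%N;
  tree_connected : connected_on [set: V];
  tree_acyclic : acyclic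
}.

Definition edges : {set {set V}} :=
  [set [set u.1; u.2] | u : V * V & e u.1 u.2].

(* The vertices after [u] on a simple path from [u] to [v] (which is unique
   when [e] is a tree); a simple path has at most [#|V|] vertices. *)
Definition simple_path (u v : V) : seq V :=
  if [pick p : {bseq #|V| of V} |
        [&& path e u p, uniq (u :: p) & last u p == v]] is Some p
  then val p else [::].

Definition unique_neighbour (S : {set V}) (u p : V) : Prop :=
  unique (fun v => v \in S /\ e u v) p.

End Trees.

Section Weights.

Variables (R : comNzRingType) (V : finType) (a : V -> V -> R).

Definition path_weight (u : V) (p : seq V) : R :=
  \sum_(l < size p) a (nth u (u :: p) l) (nth u (u :: p) l.+1).

(* For [f = [set i; j]] with [i != j], these are [a i j + a j i] and
   [a i j * a j i]. *)
Definition edge_sum (f : {set V}) : R :=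
  \sum_(i in f) \sum_(j in f | j != i) a i j.

Definition edge_prod (f : {set V}) : R :=
  \prod_(i in f) \prod_(j in f | j != i) a i j.

End Weights.

Definition dist_mx (R : comNzRingType) n (e : rel 'I_n) (a : 'I_n -> 'I_n -> R) :
  'M[R]_n := \matrix_(i, j) path_weight a i (simple_path e i j).

Section Minors.

Variables (R : comNzRingType) (n : nat).

(* [enum_val] lists a subset of ['I_n] increasingly, so the remaining rows and
   columns keep their order. *)
Definition del_mx (M : 'M[R]_n) (I J : {set 'I_n}) : 'M[R]_(#|~: I|, #|~: J|) :=
  mxsub (fun k => enum_val k) (fun k => enum_val k) M.

Lemma card_setC_eq (I J : {set 'I_n}) : #|I| = #|J| -> #|~: J| = #|~: I|.
Proof. by move=> eqIJ; rewrite [LHS]cardsCs [RHS]cardsCs !setCK eqIJ. Qed.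

Definition del_minor (M : 'M[R]_n) (I J : {set 'I_n}) (eqIJ : #|I| = #|J|) : R :=
  \det (castmx (erefl #|~: I|, card_setC_eq eqIJ) (del_mx M I J)).

End Minors.

Definition symdiff n (I J : {set 'I_n}) : {set 'I_n} := (I :\: J) :|: (J :\: I).

(* The sign of a minor with different deleted row and column sets depends on
   the labelling of the vertices.  When [I :\: J = [set i0]] and
   [J :\: I = [set j0]], it is governed by the surviving labels outside the
   interval spanned by [i0] and [j0]; there are none when [i0] and [j0] are the
   first and last labels of [~: (I :&: J)]. *)
Definition outer_labels n (I J : {set 'I_n}) (i0 j0 : 'I_n) : {set 'I_n} :=
  [set k in ~: (I :|: J) | (k < minn i0 j0)%N || (maxn i0 j0 < k)%N].

(* Main.v *)
(* Root the tree at a vertex [r] outside [I :|: J'] and subtract from every row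
   (column) of a vertex [v != r] the row (column) of its parent.  Since [~: I]
   and [~: J'] are connected and contain [r], both are closed under parents, so
   these unimodular operations act on the submatrix itself.  Two adjacent
   vertices lie on the same side of every edge but the one joining them, so the
   second differences of the distance vanish off the diagonal: only the row and
   the column of [r] and the diagonal entries [- (a_e + a'_e)] survive.  The
   minors of such an arrow matrix are read off from the few permutations whose
   Leibniz term is nonzero. *)
Require Import Defs.
From mathcomp Require Import all_boot all_order all_algebra all_fingroup.

Set Implicit Arguments.
Unset Strict Implicit.
Unset Printing Implicit Defensive.

Import GRing.Theory.
Local Open Scope ring_scope.

(** * Unique simple paths in a tree and the two sides of an edge *)

Section SimplePaths.

Variables (V : finType) (e : rel V).
Hypothesis treeT : is_tree e.

Definition is_simple_path (u v : V) (p : seq V) :=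
  [&& path e u p, uniq (u :: p) & last u p == v].

(* The first vertex [z] of [s] lying on [t] closes a cycle, which acyclicity
   forces to be an edge. *)
Lemma head_simple_path u s t :
  path e u s -> uniq (u :: s) -> path e u t -> uniq (u :: t) ->
  has [in t] s -> head u s = head u t.
Proof.
move=> + + + + hast.
case/split_find: hast => z p1 p2 zt p1Nt.
rewrite cat_rcons.
case/splitPr: t / zt p1Nt => q1 q2 p1Nt.
rewrite !cat_path /= => /and3P[pathp1 ez _] /andP[uNp uniqp].
move=> /and3P[pathq1 ez' _] /andP[uNq uniqq].
have : ucycle e (u :: p1 ++ z :: rev q1).
  apply/andP; split.
    rewrite /= rcons_cat cat_path pathp1 /= ez /=.
    have := rev_path e u (rcons q1 z).
    rewrite last_rcons belast_rcons rev_cons => ->.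
    rewrite (eq_path (e' := e)) ?rcons_path ?pathq1 // => i j.
    exact: tree_sym treeT _ _.
  move: uNp uNq uniqp uniqq p1Nt.
  rewrite /= !mem_cat !inE !cat_uniq /= !mem_rev rev_uniq.
  rewrite !negb_or => /and3P[-> -> _] /and3P[-> _ _] /= /and3P[-> + _].
  move=> /andP[-> _] /and3P[-> + _].
  move=> /andP[-> _] /=; rewrite andbT.
  apply: contra => /hasP[i]; rewrite mem_rev => iq ip.
  by apply/hasP; exists i => //=; rewrite mem_cat iq.
move/(tree_acyclic treeT); rewrite /= size_cat /= size_rev.
case: p1 {pathp1 ez uNp uniqp p1Nt} => [|? ?]; last by rewrite /= addnS.
by case: q1 {pathq1 ez' uNq uniqq} => [|? ?].
Qed.

(** Two nonempty simple paths to [v] share the vertex [v], so [head_simple_path] makes their first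
    steps agree; the rest follows by induction. *)
Lemma is_simple_path_inj u v p q :
  is_simple_path u v p -> is_simple_path u v q -> p = q.
Proof.
elim: p u q => [|x p IHp] u q /and3P[pathp uniqp /eqP lastp].
  case: q => // y q /and3P[_ /andP[/negP uNq _] /eqP /= lastq].
  by case: uNq; rewrite -[u]/(last u [::]) lastp -lastq mem_last.
case: q => [|y q] /and3P[pathq uniqq /eqP lastq].
  by case/andP: uniqp => /negP[]; rewrite -[u]/(last u [::]) lastq -lastp /= mem_last.
have /(head_simple_path pathp uniqp pathq uniqq)/= eqxy : has [in y :: q] (x :: p).
  by apply/hasP; exists v; [rewrite -lastp | rewrite /= -lastq]; rewrite /= mem_last.
rewrite -{y}eqxy in pathq uniqq lastq *; congr (_ :: _).
case/andP: pathp => _ pathp; case/andP: pathq => _ pathq.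
case/andP: uniqp => _ uniqp; case/andP: uniqq => _ uniqq.
by apply: (IHp x); apply/and3P; split=> //; apply/eqP.
Qed.

(** Shortening a walk inside [S] never leaves [S]. By uniqueness the tree path is then this one,
    which is why connected vertex sets containing the root are closed under parents. *)
Lemma simple_path_in (S : {set V}) u v : connected_on e S -> u \in S -> v \in S ->
  exists2 p, is_simple_path u v p & {subset p <= S}.
Proof.
move=> connS uS vS.
have /connectP[p pathp ->] := connS u v uS vS.
case/shortenP: pathp => q pathq uniqq _; exists q.
  rewrite /is_simple_path uniqq eqxx !andbT.
  by apply: sub_path pathq => x y /and3P[].
elim: q u {uS uniqq} pathq => [|y q IHq] u //= /andP[/and3P[_ yS _] /IHq sq].
by move=> z; rewrite inE => /predU1P[->|/sq].
Qed.

Lemma simple_pathP u v : is_simple_path u v (simple_path e u v).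
Proof.
rewrite /simple_path; case: pickP => [p //|none].
have [p pP _] := simple_path_in (tree_connected treeT) (in_setT u) (in_setT v).
have size_p : (size p <= #|V|)%N.
  case/and3P: pP => _ uniqp _; apply: ltnW.
  by rewrite -[(_ < _)%N]/(size (u :: p) <= _)%N -(card_uniqP uniqp) max_card.
by have := none (Bseq size_p); rewrite /= => /negP[].
Qed.

Lemma simple_path_eq u v p : is_simple_path u v p -> simple_path e u v = p.
Proof. exact/is_simple_path_inj/simple_pathP. Qed.

Lemma simple_pathxx u : simple_path e u u = [::].
Proof. by apply: simple_path_eq; rewrite /is_simple_path /= eqxx. Qed.

Lemma simple_path_edge u v : e u v -> simple_path e u v = [:: v].
Proof.
move=> euv; apply: simple_path_eq; rewrite /is_simple_path /= euv eqxx !inE !andbT.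
by apply: contraTneq euv => ->; rewrite (tree_irr treeT).
Qed.

Lemma simple_path_sub u v (S : {set V}) :
  connected_on e S -> u \in S -> v \in S -> {subset simple_path e u v <= S}.
Proof.
by move=> connS uS vS; have [p /simple_path_eq->] := simple_path_in connS uS vS.
Qed.

Lemma simple_path_rev u v :
  simple_path e v u = rev (belast u (simple_path e u v)).
Proof.
apply: simple_path_eq; have /and3P[pathp uniqp /eqP lastp] := simple_pathP u v.
move: pathp uniqp lastp; set p := simple_path _ _ _ => pathp uniqp lastp.
apply/and3P; split.
- rewrite -lastp rev_path (eq_path (e' := e)) // => i j.
  exact: tree_sym treeT _ _.
- by rewrite -lastp -rev_rcons -lastI rev_uniq.
- by case: (p) lastp => [<- //|x q _]; rewrite /= rev_cons last_rcons.
Qed.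

(** For an edge [{u, v}] this says that [w] lies on the side of [v] once the edge is removed. *)
Definition beyond (u v w : V) := v \in simple_path e u w.

Lemma beyond_simple_path u v w : e u v ->
  beyond u v w -> simple_path e u w = v :: simple_path e v w.
Proof.
rewrite /beyond => euv vp; have /and3P[pathp uniqp /eqP lastp] := simple_pathP u w.
have := head_simple_path pathp uniqp (t := [:: v]).
rewrite /= andbT euv inE andbT.
have -> : has [in [:: v]] (simple_path e u w).
  by apply/hasP; exists v; rewrite ?inE.
have -> : u != v by apply: contraTneq euv => ->; rewrite (tree_irr treeT).
move/(_ isT isT isT) => headp; move: vp pathp uniqp lastp headp.
case: simple_path => // x q _ /= /andP[_ pathq] /andP[_ uniqq] lastq Ex.
rewrite Ex in pathq uniqq lastq *; congr (_ :: _).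
by apply/esym/simple_path_eq/and3P; split=> //; apply/eqP.
Qed.

(** If the path from [u] to [w] avoids [v], prefixing the edge to it yields the path from [v] to
    [w], which passes through [u]; if it starts with [v], its tail avoids [u] by simplicity. *)
Lemma beyondC u v w : e u v -> beyond v u w = ~~ beyond u v w.
Proof.
move=> euv; have /and3P[pathp uniqp lastp] := simple_pathP u w.
have [vp|vNp] := boolP (beyond u v w).
  move: uniqp; rewrite (beyond_simple_path euv vp) => /andP[+ _].
  by rewrite inE negb_or => /andP[_ /negPf].
rewrite /beyond (@simple_path_eq v w (u :: simple_path e u w)) ?mem_head //.
apply/and3P; split=> //=; first by rewrite (tree_sym treeT) euv.
rewrite inE negb_or [v \in _](negPf vNp) andbT [_ && uniq _]uniqp andbT.
by apply: contraTneq euv => ->; rewrite (tree_irr treeT).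
Qed.

(* Only the edge [{u, v}] joins the two sides of [{u, v}]. *)
Lemma beyond_edge u v i j : e u v -> e i j ->
  beyond u v i -> ~~ beyond u v j -> i = v /\ j = u.
Proof.
move=> euv eij ui; have /and3P[pathp uniqp /eqP lastp] := simple_pathP u i.
have [jp|] := boolP (j \in u :: simple_path e u i).
  case/predU1P: jp => [Ej _|jp].
    move: ui; rewrite Ej (tree_sym treeT) in eij *.
    by rewrite /beyond simple_path_edge // inE => /eqP->.
  case/negP; move: pathp uniqp lastp (beyond_simple_path euv ui); rewrite /beyond.
  case/splitPr: jp => p1 p2; rewrite -cat_rcons cat_path => /andP[pathp _].
  rewrite -cat_cons cat_uniq => /andP[uniqp _] _ Ep.
  rewrite (@simple_path_eq u j (rcons p1 j)); last first.
    by apply/and3P; split=> //; rewrite last_rcons.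
  by case: p1 Ep {pathp uniqp} => [|x p1] /= [-> _]; rewrite mem_head.
move=> jNp /negP[].
rewrite /beyond (@simple_path_eq u j (rcons (simple_path e u i) j)).
  by rewrite mem_rcons inE [v \in _]ui orbT.
apply/and3P; split; last by rewrite last_rcons.
  by rewrite rcons_path pathp lastp.
by rewrite -rcons_cons rcons_uniq jNp.
Qed.

Lemma simple_path_rcons u v w : e u v -> ~~ beyond u v w ->
  simple_path e w v = rcons (simple_path e w u) v.
Proof.
move=> euv vNp; apply: simple_path_eq.
have /and3P[pathp uniqp /eqP lastp] := simple_pathP w u.
apply/and3P; split; last by rewrite last_rcons.
  by rewrite rcons_path pathp lastp.
rewrite -rcons_cons rcons_uniq uniqp andbT.
have := simple_path_rev w u; rewrite /beyond in vNp.
rewrite lastI lastp mem_rcons inE negb_or -mem_rev => <-; rewrite vNp andbT.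
by apply: contraTneq euv => ->; rewrite (tree_irr treeT).
Qed.

(** * Parents, depth and parent edges in the tree rooted at [r] *)

Section Rooted.

Variable r : V.

Definition parent v := head r (simple_path e v r).

Definition depth v := size (simple_path e v r).

Lemma parent_eq u v : e u v -> beyond u v r -> parent u = v.
Proof. by move=> euv ur; rewrite /parent (beyond_simple_path euv ur). Qed.

Lemma beyond_root u v : beyond u v r -> u != r.
Proof. by apply: contraTneq => ->; rewrite /beyond simple_pathxx. Qed.

Lemma simple_path_parent v : v != r ->
  e v (parent v) /\ beyond v (parent v) r.
Proof.
move=> vr; rewrite /parent /beyond.
have /and3P[+ _] := simple_pathP v r.
case: simple_path => [|x p] /=; first by rewrite (negPf vr).
by case/andP=> ->; rewrite mem_head.
Qed.

Lemma edge_parent v : v != r -> e v (parent v).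
Proof. by case/simple_path_parent. Qed.

Lemma beyond_parent v : v != r -> beyond v (parent v) r.
Proof. by case/simple_path_parent. Qed.

Lemma depth_parent v : v != r -> depth v = (depth (parent v)).+1.
Proof.
by move=> vr; rewrite /depth (beyond_simple_path (edge_parent vr) (beyond_parent vr)).
Qed.

Lemma parent_neq v : v != r -> parent v != v.
Proof.
by move=> vr; apply: contraTneq (edge_parent vr) => ->; rewrite (tree_irr treeT).
Qed.

(** Otherwise two parent steps would lead from [u] back to [u], although each lowers the depth by
    one. *)
Lemma parent_parent_neq u v : u != r -> v != r -> v = parent u -> u != parent v.
Proof.
move=> ur vr Ev; apply: contraTneq isT => Eu.
have := depth_parent ur; rewrite -Ev (depth_parent vr) -Eu => /eqP.
by rewrite -addn2 -[X in X == _]addn0 eqn_add2l.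
Qed.

Lemma edge_root u v : e u v ->
  (u != r /\ v = parent u) \/ (v != r /\ u = parent v).
Proof.
move=> euv; have [ur|] := boolP (beyond u v r); [left | rewrite -beyondC // => vr; right].
  by rewrite (beyond_root ur) (parent_eq euv ur).
by rewrite (beyond_root vr) (parent_eq _ vr) // (tree_sym treeT).
Qed.

Lemma parent_in (S : {set V}) v :
  connected_on e S -> r \in S -> v \in S -> v != r -> parent v \in S.
Proof.
by move=> connS rS vS /beyond_parent; apply: simple_path_sub.
Qed.

(* The edges [{v, parent v}] and [{u, parent u}] differ. *)
Lemma beyond_parentE u v : u != r -> v != r -> u != v ->
  beyond u (parent u) v = beyond u (parent u) (parent v).
Proof.
move=> ur vr uv; have eu := edge_parent ur; have ev := edge_parent vr.
apply/idP/idP => [Bv|Bpv]; apply: contraT => NB.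
  have [Ev Epv] := beyond_edge eu ev Bv NB.
  by have := parent_parent_neq ur vr Ev; rewrite Epv eqxx.
rewrite (tree_sym treeT) in ev.
by have [_ Ev] := beyond_edge eu ev Bpv NB; rewrite Ev eqxx in uv.
Qed.

(** Of the two ends of an edge, the one separated by it from [r] is the child. Together with
    [parent_edge_inj] this turns products over edges into products over non-root vertices. *)
Lemma edgesE (S : {set V}) : (forall v, v \in S -> v != r -> parent v \in S) ->
  [set f in edges e | f \subset S] = [set [set v; parent v] | v in S :\ r].
Proof.
move=> parentS; apply/setP => f; rewrite inE; apply/andP/imsetP.
  case=> /imsetP[[u v]]; rewrite inE /= => euv ->.
  rewrite subUset !sub1set => /andP[uS vS].
  case: (edge_root euv) => -[wr E]; [exists u | exists v]; rewrite ?inE ?wr ?E //.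
  by rewrite setUC.
case=> v; rewrite !inE => /andP[vr vS] ->; split.
  by apply/imsetP; exists (v, parent v); rewrite ?inE //= edge_parent.
by rewrite subUset !sub1set vS parentS.
Qed.

Lemma parent_edge_inj : {in predC1 r &, injective (fun v => [set v; parent v])}.
Proof.
move=> u v; rewrite !inE => ur vr E.
have := set21 u (parent u); rewrite E !inE => /orP[/eqP//|/eqP Eu].
have := set21 v (parent v); rewrite -E !inE => /orP[/eqP//|/eqP Ev].
by have := parent_parent_neq ur vr Ev; rewrite -Eu eqxx.
Qed.

End Rooted.

End SimplePaths.

(** * Weighted distances and their differences along an edge *)

Section Distances.

Variables (R : comNzRingType) (V : finType) (a : V -> V -> R).

Lemma path_weight_cons u v p :
  path_weight a u (v :: p) = a u v + path_weight a v p.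
Proof.
rewrite /path_weight big_ord_recl /=; congr (_ + _).
apply: eq_bigr => i _; rewrite /bump /= add0n.
by rewrite (set_nth_default v u) /= 1?ltnW ?ltnS // (set_nth_default v u).
Qed.

Lemma path_weight_rcons u v p :
  path_weight a u (rcons p v) = path_weight a u p + a (last u p) v.
Proof.
elim: p u => [|w p IHp] u /=; last by rewrite !path_weight_cons IHp addrA.
by rewrite path_weight_cons /path_weight !big_ord0 addr0 add0r.
Qed.

Lemma edge_sum2 u v : u != v -> edge_sum a [set u; v] = a u v + a v u.
Proof.
move=> uv; rewrite /edge_sum big_setU1 ?inE // big_set1; congr (_ + _).
  by rewrite big_mkcondr big_setU1 ?inE // big_set1 eqxx /= eq_sym uv add0r.
by rewrite big_mkcondr big_setU1 ?inE // big_set1 eqxx /= uv addr0.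
Qed.

Lemma edge_prod2 u v : u != v -> edge_prod a [set u; v] = a u v * a v u.
Proof.
move=> uv; rewrite /edge_prod big_setU1 ?inE // big_set1; congr (_ * _).
  by rewrite big_mkcondr big_setU1 ?inE // big_set1 eqxx /= eq_sym uv mul1r.
by rewrite big_mkcondr big_setU1 ?inE // big_set1 eqxx /= uv mulr1.
Qed.

Variable e : rel V.
Hypothesis treeT : is_tree e.

Definition tree_dist u w := path_weight a u (simple_path e u w).

Lemma tree_distxx u : tree_dist u u = 0.
Proof. by rewrite /tree_dist (simple_pathxx treeT) /path_weight big_ord0. Qed.

(** One of the two paths to [w] is the other one preceded by the edge, so the difference depends
    only on the side of the edge that contains [w]. *)
Lemma tree_dist_beyond u v w : e u v ->
  tree_dist u w - tree_dist v w = if beyond e u v w then a u v else - a v u.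
Proof.
move=> euv; rewrite /tree_dist; case: ifP => [uw|].
  by rewrite (beyond_simple_path treeT euv uw) path_weight_cons addrK.
move/negbT; rewrite -(beyondC treeT _ euv) => vw.
rewrite (beyond_simple_path treeT _ vw) 1?(tree_sym treeT) //.
by rewrite path_weight_cons opprD addrCA subrr addr0.
Qed.

Lemma tree_dist_root r v : v != r ->
  tree_dist r v = tree_dist r (parent e r v) + a (parent e r v) v.
Proof.
move=> vr; have ev := edge_parent treeT vr.
rewrite /tree_dist (simple_path_rcons treeT (u := parent e r v)).
- rewrite path_weight_rcons; congr (_ + a _ _).
  by case/and3P: (simple_pathP treeT r (parent e r v)) => _ _ /eqP.
- by rewrite (tree_sym treeT).
- by rewrite -(beyondC treeT) 1?(tree_sym treeT) // (beyond_parent treeT vr).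
Qed.

End Distances.

(** * Leibniz sums with at most one nonzero term *)

Section Transversals.

Variables (R : comNzRingType) (n : nat).
Implicit Types (A : 'M[R]_n) (s t : 'S_n).

Lemma prod_neq0 (P : pred 'I_n) (F : 'I_n -> R) i :
  \prod_(k | P k) F k != 0 -> P i -> F i != 0.
Proof. by move=> + Pi; apply: contraNneq => Fi0; rewrite (bigD1 i) //= Fi0 mul0r. Qed.

Lemma det_transversal A s :
  (forall t, (forall i, A i (t i) != 0) -> t = s) ->
  \det A = (-1) ^+ s * \prod_i A i (s i).
Proof.
move=> tE; rewrite /determinant (bigD1 s) //= [X in _ + X]big1 ?addr0 // => t ts.
have [->|nz] := eqVneq (\prod_i A i (t i)) 0; first by rewrite mulr0.
by rewrite (tE t) ?eqxx // in ts => i; apply: prod_neq0 nz _.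
Qed.

Lemma det_no_transversal A :
  (forall t, ~ (forall i, A i (t i) != 0)) -> \det A = 0.
Proof.
move=> tF; rewrite /determinant [LHS]big1 // => t _.
have [->|nz] := eqVneq (\prod_i A i (t i)) 0; first by rewrite mulr0.
by case: (tF t) => i; apply: prod_neq0 nz _.
Qed.

(** The cofactor is a Leibniz sum over the permutations sending [i] to [j], in which the entry of
    row [i] itself does not occur. *)
Lemma cofactor_transversal A i j s : s i = j ->
  (forall t, t i = j -> (forall k, k != i -> A k (t k) != 0) -> t = s) ->
  cofactor A i j = (-1) ^+ s * \prod_(k | k != i) A k (s k).
Proof.
move=> si tE; rewrite expand_cofactor (bigD1 s) /= ?si // [X in _ + X]big1 ?addr0.
  by congr (_ * _); apply: eq_bigl => k; rewrite eq_sym.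
move=> t /andP[/eqP ti ts].
have [->|nz] := eqVneq (\prod_(k | i != k) A k (t k)) 0; first by rewrite mulr0.
by rewrite (tE t) ?eqxx // in ts => k ki; apply: prod_neq0 nz _; rewrite eq_sym.
Qed.

End Transversals.

(** * Determinant and cofactors of an arrow matrix *)

Section Arrow.

Variables (R : comNzRingType) (n : nat) (A : 'M[R]_n) (r : 'I_n).

Definition arrow_mx := forall i j, i != r -> j != r -> i != j -> A i j = 0.

Hypothesis arrowA : arrow_mx.

Lemma arrow_neq0 i j : i != r -> A i j != 0 -> j = r \/ j = i.
Proof.
move=> ir; have [->|jr] := eqVneq j r; first by left.
by have [->|ij] := eqVneq j i; [right | rewrite arrowA ?eqxx // eq_sym].
Qed.

(** Column [r] is taken by row [i], so injectivity leaves every other non-root row only its diagonal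
    entry. *)
Lemma arrow_transversal (t : 'S_n) i : i != r -> t i = r ->
  forall k, k != r -> k != i -> A k (t k) != 0 -> t k = k.
Proof.
move=> ir ti k kr ki /(arrow_neq0 kr)[] // tk.
by move: ki; rewrite -(inj_eq (@perm_inj _ t)) ti tk eqxx.
Qed.

Lemma arrow_cofactor_root : cofactor A r r = \prod_(k | k != r) A k k.
Proof.
rewrite (@cofactor_transversal _ _ A r r 1) ?perm1 //.
  by rewrite odd_perm1 mul1r; apply: eq_bigr => k _; rewrite perm1.
move=> t tr nz; apply/permP => k; rewrite perm1.
have [->//|kr] := eqVneq k r.
case: (arrow_neq0 kr (nz k kr)) => // tk.
by move: kr; rewrite -(inj_eq (@perm_inj _ t)) tr tk eqxx.
Qed.

(** Row [j] cannot use its diagonal column, which row [r] occupies, so it must use column [r]: the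
    only transversal is the transposition of [r] and [j], whence the minus sign. *)
Lemma arrow_cofactor_row j : j != r ->
  cofactor A r j = - (A j r * \prod_(k | (k != r) && (k != j)) A k k).
Proof.
move=> jr; rewrite (@cofactor_transversal _ _ A r j (tperm r j)) ?tpermL //.
  rewrite odd_tperm eq_sym jr mulN1r (bigD1 j) //= tpermR; congr (- (_ * _)).
  by apply: eq_bigr => k /andP[kr kj]; rewrite tpermD // eq_sym.
move=> t tr nz.
have tj : t j = r.
  case: (arrow_neq0 jr (nz j jr)) => // tj.
  by move: jr; rewrite -(inj_eq (@perm_inj _ t)) tr tj eqxx.
apply/permP => k; case: tpermP => [->|->|/eqP kr /eqP kj] //.
exact: arrow_transversal tj _ _ _ (nz _ _).
Qed.

Lemma arrow_det :
  \det A = A r r * \prod_(k | k != r) A k k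
    - \sum_(j | j != r) A r j * A j r * \prod_(k | (k != r) && (k != j)) A k k.
Proof.
rewrite (expand_det_row _ r) (bigD1 r) //= arrow_cofactor_root -sumrN.
congr (_ + _); apply: eq_bigr => j jr.
by rewrite arrow_cofactor_row // mulrN mulrA.
Qed.

(* The only transversal is the 3-cycle [i -> j -> r -> i]. *)
Lemma arrow_cofactor i j : i != r -> j != r -> i != j ->
  cofactor A i j =
    A r i * A j r * \prod_(k | [&& k != r, k != i & k != j]) A k k.
Proof.
move=> ir jr ij; pose s : 'S_n := (tperm i j * tperm i r)%g.
have si : s i = j by rewrite permM tpermL tpermD // eq_sym.
have sj : s j = r by rewrite permM tpermR tpermL.
have sr : s r = i by rewrite permM (tpermD ir jr) tpermR.
have sk k : k != r -> k != i -> k != j -> s k = k.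
  by move=> kr ki kj; rewrite permM !tpermD // 1?eq_sym.
rewrite (cofactor_transversal si).
  rewrite odd_permM !odd_tperm ij ir mul1r (bigD1 r) 1?eq_sym //= sr.
  rewrite (bigD1 j) /= ?jr 1?[_ == i]eq_sym ?ij // sj -mulrA.
  congr (_ * (_ * _)); apply: eq_big => [k|k /andP[/andP[ki kr] kj]].
    by rewrite andbA [(k != i) && _]andbC.
  by rewrite sk.
move=> t ti nz.
have tj : t j = r.
  case: (arrow_neq0 jr (nz j _)) => //; first by rewrite eq_sym.
  by move=> tj; move: ij; rewrite -(inj_eq (@perm_inj _ t)) ti tj eqxx.
have tk k : k != r -> k != i -> k != j -> t k = k.
  by move=> kr ki kj; apply: arrow_transversal tj _ _ _ (nz _ _).
have tr : t r = i.
  have [k tk'] : exists k, t k = i by exists (t^-1%g i); rewrite permKV.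
  suff -> : r = k by [].
  apply/eqP; apply: contraT; rewrite eq_sym => kr.
  have [Ek|ki] := eqVneq k i; first by rewrite -tk' Ek ti eqxx in ij.
  have [Ek|kj] := eqVneq k j; first by rewrite -tk' Ek tj eqxx in ir.
  by move: (ki); rewrite -tk' tk // eqxx.
apply/permP => k.
have [->|kr] := eqVneq k r; first by rewrite tr sr.
have [->|ki] := eqVneq k i; first by rewrite ti si.
have [->|kj] := eqVneq k j; first by rewrite tj sj.
by rewrite tk // sk.
Qed.

End Arrow.

(** * Matrices indexed by vertex sequences and their unimodular reductions *)

Section SeqMatrix.

Variables (R : comNzRingType) (V : finType) (r : V).
Implicit Types (F : V -> V -> R) (s t : seq V).

(** Keeping the size [n] apart from the sequences lets matrices on different row and column sets
    share one square type; [r] is only the default of [nth]. *)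
Definition seq_mx n F s t : 'M[R]_n := \matrix_(i, j) F (nth r s i) (nth r t j).

Lemma mul_seq_mx n F G s t u : size t = n ->
  seq_mx n F s t *m seq_mx n G t u =
  seq_mx n (fun x y => \sum_(z <- t) F x z * G z y) s u.
Proof.
move=> <-; apply/matrixP => i j; rewrite !mxE (big_nth r) big_mkord.
by apply: eq_bigr => k _; rewrite !mxE.
Qed.

Lemma nth_rem x s k : nth r (rem x s) k = nth r s (bump (index x s) k).
Proof.
elim: s k => [|y s IHs] k /=; first by rewrite !nth_nil.
case: eqP => // _; case: k => [|k] //=.
by rewrite IHs bumpS.
Qed.

Lemma seq_mx_rem n F s t x y (i j : 'I_n.+1) : index x s = i -> index y t = j ->
  seq_mx n F (rem x s) (rem y t) = row' i (col' j (seq_mx n.+1 F s t)).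
Proof. by move=> Ei Ej; apply/matrixP => k l; rewrite !mxE !nth_rem Ei Ej. Qed.

Lemma sum_delta s x (G : V -> R) : uniq s -> x \in s ->
  \sum_(z <- s) (x == z)%:R * G z = G x.
Proof.
move=> us xs; rewrite big_uniq //= (bigD1 x) //= eqxx mul1r big1 ?addr0 //.
by move=> z /andP[_ zx]; rewrite eq_sym (negPf zx) mul0r.
Qed.

Variables (par : V -> V) (dep : V -> nat).
Hypothesis dep_par : forall v, v != r -> (dep (par v) < dep v)%N.

Definition par_closed s := forall v, v \in s -> v != r -> par v \in s.

Definition row_reduce F u v := F u v - (if u == r then 0 else F (par u) v).

Definition col_reduce F u v := F u v - (if v == r then 0 else F u (par v)).

(** Left multiplication by this matrix performs [row_reduce]. Ordered by [dep] it is triangular with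
    unit diagonal. *)
Definition par_coef u v : R :=
  (u == v)%:R - (if u == r then 0 else (par u == v)%:R).

(* [dep] weakly decreases along a transversal but has the same total over both
   of its ends, so the identity is the only transversal. *)
Lemma det_par_coef n s : uniq s -> size s = n -> \det (seq_mx n par_coef s s) = 1.
Proof.
move=> us sn; rewrite (@det_transversal _ _ _ 1).
  rewrite odd_perm1 mul1r big1 // => i _; rewrite perm1 mxE /par_coef eqxx.
  have [_|/dep_par] := eqVneq (nth r s i) r; first by rewrite subr0.
  by have [->|_ _] := eqVneq (par _) _; rewrite ?ltnn ?subr0.
move=> t nz; pose d (i : 'I_n) := dep (nth r s i).
have dt i : (d (t i) <= d i ?= iff (t i == i))%N.
  move: (nz i); rewrite mxE /par_coef.
  have -> : (nth r s i == nth r s (t i)) = (t i == i).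
    by rewrite nth_uniq ?sn // eq_sym.
  have [-> _|_] := eqVneq (t i) i; first exact/leqif_refl.
  have [_|/dep_par lt_dep] := eqVneq (nth r s i) r; first by rewrite subr0 eqxx.
  have [Ed _|_] := eqVneq (par _) _; last by rewrite subr0 eqxx.
  by rewrite Ed in lt_dep; split; [apply: ltnW | apply: ltn_eqF].
have /leqif_sum[_] := fun i (_ : predT i) => dt i.
rewrite [X in _ == X](reindex_inj (@perm_inj _ t)) eqxx => /esym/forallP tE.
by apply/permP => i; rewrite perm1; apply/eqP/tE.
Qed.

(** Closure of [s] under parents ensures that the row subtracted from that of [u] is a row of the
    same matrix, so the reduction is a product with a matrix of determinant 1. *)
Lemma det_row_reduce n F s t : uniq s -> size s = n -> par_closed s ->
  \det (seq_mx n (row_reduce F) s t) = \det (seq_mx n F s t).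
Proof.
move=> us sn cs; rewrite -[RHS]mul1r -(det_par_coef us sn) -det_mulmx.
rewrite mul_seq_mx //; congr (\det _); apply/matrixP => i j; rewrite !mxE.
have : nth r s i \in s by rewrite mem_nth // sn.
move: (nth r s i) (nth r t j) => u v us'.
under [RHS]eq_bigr => z do rewrite /par_coef mulrBl.
rewrite sumrB sum_delta // /row_reduce; congr (_ - _).
case: eqVneq => [_|ur]; first by rewrite big1 // => z _; rewrite mul0r.
by rewrite sum_delta // cs.
Qed.

Lemma det_col_reduce n F s t : uniq t -> size t = n -> par_closed t ->
  \det (seq_mx n (col_reduce F) s t) = \det (seq_mx n F s t).
Proof.
move=> ut tn ct; rewrite -det_tr -[RHS]det_tr.
transitivity (\det (seq_mx n (row_reduce (fun x y => F y x)) t s)).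
  by congr (\det _); apply/matrixP => i j; rewrite !mxE.
by rewrite det_row_reduce //; congr (\det _); apply/matrixP => i j; rewrite !mxE.
Qed.

End SeqMatrix.

(** * Arrow matrices on a vertex set, with positions translated into vertices *)

Section ArrowSubmatrix.

Variables (R : comNzRingType) (V : finType) (r : V) (G : V -> V -> R).
Hypothesis arrowG : forall u v, u != r -> v != r -> u != v -> G u v = 0.

Lemma big_ord_nth (T : Type) (idx : T) (op : T -> T -> T) n (s : seq V)
    (P : pred V) (F : V -> T) : size s = n ->
  \big[op/idx]_(i < n | P (nth r s i)) F (nth r s i) =
  \big[op/idx]_(v <- s | P v) F v.
Proof. by move=> <-; rewrite (big_nth r) big_mkord. Qed.

Lemma enum_setD1 (W : {set V}) v : enum (W :\ v) = rem v (enum W).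
Proof.
rewrite rem_filter ?enum_uniq // /enum_mem -filter_predI.
by apply: eq_filter => u; rewrite /= !inE.
Qed.

Section Enumeration.

Variables (W : {set V}) (n : nat).
Hypotheses (rW : r \in W) (sizeW : size (enum W) = n).

Lemma index_enum_ltn v : v \in W -> (index v (enum W) < n)%N.
Proof. by move=> vW; rewrite -sizeW index_mem mem_enum. Qed.

Let pos v vW := Ordinal (@index_enum_ltn v vW).

Let nth_pos v (vW : v \in W) : nth r (enum W) (pos vW) = v.
Proof. by rewrite nth_index ?mem_enum. Qed.

Let nth_neq (k l : 'I_n) : (k != l) = (nth r (enum W) k != nth r (enum W) l).
Proof. by rewrite nth_uniq ?sizeW // enum_uniq. Qed.

Lemma arrow_seq_mx : arrow_mx (seq_mx r n G (enum W) (enum W)) (pos rW).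
Proof. by move=> i j; rewrite !nth_neq nth_pos mxE; apply: arrowG. Qed.

Let big_pos (T : Type) (idx : T) (op : Monoid.com_law idx) (P : pred V)
    (Q : pred 'I_n) (S : {set V}) (F : V -> T) (F' : 'I_n -> T) :
  S = [set v in W | P v] ->
  (forall k : 'I_n, Q k = P (nth r (enum W) k)) ->
  (forall k : 'I_n, Q k -> F' k = F (nth r (enum W) k)) ->
  \big[op/idx]_(k < n | Q k) F' k = \big[op/idx]_(v in S) F v.
Proof.
move=> -> QP F'F; under [RHS]eq_bigl => v do rewrite inE.
by rewrite -[RHS]big_enum_cond -[RHS](big_ord_nth _ _ _ _ sizeW); apply: eq_big.
Qed.

Lemma det_arrow_seq : \det (seq_mx r n G (enum W) (enum W)) =
  G r r * \prod_(v in W :\ r) G v v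
    - \sum_(u in W :\ r) G r u * G u r * \prod_(v in W :\ r :\ u) G v v.
Proof.
rewrite (arrow_det arrow_seq_mx) mxE nth_pos; congr (_ * _ - _).
  apply: (@big_pos _ _ _ (predC1 r)) => [|k|k _]; rewrite ?nth_neq ?nth_pos ?mxE //.
  by apply/setP => v; rewrite !inE andbC.
apply: (@big_pos _ _ _ (predC1 r)) => [|k|k _]; rewrite ?nth_neq ?nth_pos //.
  by apply/setP => v; rewrite !inE andbC.
rewrite !mxE nth_pos; congr (_ * _).
apply: (@big_pos _ _ _ (fun v => (v != r) && (v != nth r (enum W) k))) => [|l|l _].
- by apply/setP => v; rewrite !inE andbA andbC [(v != r) && _]andbC.
- by rewrite !nth_neq nth_pos.
- by rewrite mxE.
Qed.

Lemma cofactor_arrow_seq (i0 j0 : V) (iW : i0 \in W) (jW : j0 \in W) :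
  i0 != r -> j0 != r -> i0 != j0 ->
  cofactor (seq_mx r n G (enum W) (enum W)) (pos iW) (pos jW) =
  G r i0 * G j0 r * \prod_(v in W :\ r :\: [set i0; j0]) G v v.
Proof.
move=> ir jr ij; rewrite (arrow_cofactor arrow_seq_mx) ?nth_neq ?nth_pos //.
rewrite !mxE !nth_pos; congr (_ * _).
apply: (@big_pos _ _ _ (fun v => [&& v != r, v != i0 & v != j0])) => [|l|l _].
- by apply/setP => v; rewrite !inE negb_or andbA andbC [(_ && _) && (v != r)]andbC.
- by rewrite !nth_neq !nth_pos.
- by rewrite mxE.
Qed.

End Enumeration.

(** Dropping [i0] and [j0] from the enumerations deletes one row and one column of the arrow matrix
    on [W], so this is a cofactor of that matrix up to its sign. *)
Lemma det_arrow_seqD1 (W : {set V}) n (i0 j0 : V) :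
  r \in W -> i0 \in W -> j0 \in W -> i0 != r -> j0 != r -> i0 != j0 ->
  #|W| = n.+1 ->
  \det (seq_mx r n G (enum (W :\ i0)) (enum (W :\ j0))) =
  (-1) ^+ (index i0 (enum W) + index j0 (enum W)) *
  (G r i0 * G j0 r * \prod_(v in W :\ r :\: [set i0; j0]) G v v).
Proof.
move=> rW iW jW ir jr ij; rewrite cardE => sizeW.
rewrite -(cofactor_arrow_seq rW sizeW iW jW) // mulrA -exprD.
(* The sign inside the cofactor meets its own copy and squares to 1. *)
rewrite -signr_odd addnn odd_double mul1r.
rewrite !enum_setD1; congr (\det _).
exact: seq_mx_rem.
Qed.

End ArrowSubmatrix.

(** * Parity of positions in the increasing enumeration of a label set *)

Section Positions.

Variable n : nat.
Implicit Types (i j k : 'I_n) (W : {set 'I_n}).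

Lemma index_sorted (s : seq 'I_n) i : sorted (fun k l => k < l)%N s -> i \in s ->
  index i s = count (fun k => k < i)%N s.
Proof.
have tr : transitive (fun k l : 'I_n => k < l)%N by move=> ? ? ?; apply: ltn_trans.
elim: s => //= x s IHs xs; rewrite inE.
have [-> _|ix] /= := eqVneq i x.
  rewrite ltnn add0n; apply/esym/eqP; rewrite -leqn0 leqNgt -has_count.
  apply/hasPn => y ys; rewrite -leqNgt ltnW //.
  by move/(order_path_min tr)/allP: xs => /(_ _ ys).
move=> ins; rewrite IHs ?(path_sorted xs) //.
by move/(order_path_min tr)/allP: xs => /(_ _ ins) ->.
Qed.

Lemma sorted_enum_set W : sorted (fun k l => k < l)%N (enum W).
Proof.
rewrite /enum_mem; apply: sorted_filter.
  by move=> ? ? ?; apply: ltn_trans.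
rewrite -enumT -(@sorted_map _ _ val ltn) val_enum_ord.
exact: iota_ltn_sorted.
Qed.

Lemma index_enum_set W i : i \in W -> index i (enum W) = #|[set k in W | (k < i)%N]|.
Proof.
move=> iW; rewrite index_sorted ?sorted_enum_set ?mem_enum //.
rewrite -sum1_count -sum1_card big_enum_cond /=.
by apply: eq_bigl => k; rewrite inE.
Qed.

(** With A labels of [W] below [i], B below [j] and C above [j], the left side counts A + B + (B +
    C), which has the parity of A + C, the number of outer labels. *)
Lemma outer_parity_lt W i j : i \in W -> j \in W -> (i < j)%N ->
  odd (index i (enum W) + index j (enum W) + #|W|.-1) =
  odd #|[set k in W :\ i :\ j | (k < i)%N || (j < k)%N]|.
Proof.
move=> iW jW ij; rewrite !index_enum_set //.
have -> : #|[set k in W :\ i :\ j | (k < i)%N || (j < k)%N]| =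
    (#|[set k in W | (k < i)%N]| + #|[set k in W | (j < k)%N]|)%N.
  rewrite -cardsUI [_ :&: _](_ : _ = set0); last first.
    apply/setP => k; rewrite !inE; apply/negP => /andP[/andP[_ ki] /andP[_ jk]].
    by have := ltn_trans (ltn_trans jk ki) ij; rewrite ltnn.
  rewrite cards0 addn0; apply: eq_card => k; rewrite !inE.
  have [->|ki] := eqVneq k i; first by rewrite !ltnn (ltnNge j) (ltnW ij) !andbF.
  have [->|kj] := eqVneq k j; first by rewrite !ltnn (ltnNge j) (ltnW ij) !andbF.
  by rewrite /= -andb_orr.
have -> : #|W|.-1 = (#|[set k in W | (k < j)%N]| + #|[set k in W | (j < k)%N]|)%N.
  rewrite -cardsUI [_ :&: _](_ : _ = set0); last first.
    apply/setP => k; rewrite !inE; apply/negP => /andP[/andP[_ kj] /andP[_ jk]].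
    by have := ltn_trans jk kj; rewrite ltnn.
  rewrite cards0 addn0 (cardsD1 j) jW /=; apply: eq_card => k; rewrite !inE.
  by rewrite -andb_orr -neq_ltn andbC.
by rewrite !oddD addbA -[X in X (+) _]addbA addbb addbF.
Qed.

Lemma outer_parity W i j : i \in W -> j \in W -> i != j ->
  odd (index i (enum W) + index j (enum W) + #|W|.-1) =
  odd #|[set k in W :\ i :\ j | (k < minn i j)%N || (maxn i j < k)%N]|.
Proof.
move=> iW jW; rewrite -val_eqE /= neq_ltn => /orP[] lt_ij.
  rewrite (minn_idPl (ltnW lt_ij)) (maxn_idPr (ltnW lt_ij)).
  exact: outer_parity_lt.
rewrite (minn_idPr (ltnW lt_ij)) (maxn_idPl (ltnW lt_ij)).
rewrite [(index i _ + _)%N]addnC outer_parity_lt // setDDl setUC -setDDl.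
by rewrite setDDl setUC -setDDl.
Qed.

End Positions.

(** * The reduced distance matrix and its minors *)

Section ReducedDistance.

Variables (R : comNzRingType) (V : finType) (e : rel V) (a : V -> V -> R) (r : V).
Hypothesis treeT : is_tree e.

Notation par := (parent e r).

(** The indeterminate is the same in every entry, so it cancels in each difference and survives the
    reduction only at [(r, r)]. *)
Definition shifted_dist u v : {poly R} := (tree_dist a e u v)%:P + 'X.

Definition reduced_dist :=
  col_reduce r par (row_reduce r par shifted_dist).

Lemma row_reduce_shifted u v : u != r ->
  row_reduce r par shifted_dist u v =
  (if beyond e u (par u) v then a u (par u) else - a (par u) u)%:P.
Proof.
move=> ur; rewrite /row_reduce (negPf ur) /shifted_dist opprD addrACA subrr addr0.
by rewrite -polyCB (tree_dist_beyond _ treeT) ?(edge_parent treeT).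
Qed.

Lemma reduced_dist_root : reduced_dist r r = 'X.
Proof.
by rewrite /reduced_dist /col_reduce /row_reduce eqxx !subr0 /shifted_dist tree_distxx ?add0r.
Qed.

Lemma reduced_dist_row v : v != r -> reduced_dist r v = (a (par v) v)%:P.
Proof.
move=> vr; rewrite /reduced_dist /col_reduce /row_reduce eqxx (negPf vr) !subr0.
rewrite /shifted_dist opprD addrACA subrr addr0 -polyCB.
by rewrite (tree_dist_root _ treeT vr) addrC addKr.
Qed.

Lemma reduced_dist_col v : v != r -> reduced_dist v r = (a v (par v))%:P.
Proof.
move=> vr; rewrite /reduced_dist /col_reduce eqxx subr0 row_reduce_shifted //.
by rewrite (beyond_parent treeT vr).
Qed.

(** Seen from [v], its parent lies across the edge and [v] does not, so the two possible values of
    the row difference are subtracted from each other. *)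
Lemma reduced_dist_diag v : v != r ->
  reduced_dist v v = - (edge_sum a [set v; par v])%:P.
Proof.
move=> vr; have ev := edge_parent treeT vr.
rewrite /reduced_dist /col_reduce (negPf vr) !row_reduce_shifted //.
rewrite edge_sum2 1?eq_sym ?(parent_neq treeT) //.
have -> : beyond e v (par v) v = false by rewrite /beyond simple_pathxx.
have -> : beyond e v (par v) (par v).
  by rewrite /beyond (simple_path_edge treeT) // mem_head.
by rewrite -polyCB -polyCN opprD addrC.
Qed.

Lemma reduced_dist_off u v : u != r -> v != r -> u != v -> reduced_dist u v = 0.
Proof.
move=> ur vr uv; rewrite /reduced_dist /col_reduce (negPf vr).
by rewrite !row_reduce_shifted // (beyond_parentE treeT ur vr uv) subrr.
Qed.

Lemma det_reduced_dist n (S T : {set V}) : #|S| = n -> #|T| = n ->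
  r \in S -> r \in T -> connected_on e S -> connected_on e T ->
  \det (seq_mx r n shifted_dist (enum S) (enum T)) =
  \det (seq_mx r n reduced_dist (enum S) (enum T)).
Proof.
move=> nS nT rS rT cS cT.
have dep_par v : v != r -> (depth e r (par v) < depth e r v)%N.
  by move=> vr; rewrite (depth_parent treeT vr).
have closed (U : {set V}) : r \in U -> connected_on e U -> par_closed r par (enum U).
  by move=> rU cU v; rewrite !mem_enum => vU vr; apply: parent_in.
rewrite (det_col_reduce dep_par) ?enum_uniq -?cardE //; last exact: closed.
by rewrite (det_row_reduce dep_par) ?enum_uniq -?cardE //; apply: closed.
Qed.

Definition parent_edge v := [set v; par v].

Lemma parent_edge_inj_in (S : {set V}) :
  r \notin S -> {in S &, injective parent_edge}.
Proof.
move=> rS u v uS vS; apply: (parent_edge_inj treeT); rewrite inE.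
  by apply: contraNneq rS => <-.
by apply: contraNneq rS => <-.
Qed.

Lemma parent_edgesD (S T : {set V}) : r \notin S -> r \notin T ->
  parent_edge @: S :\: parent_edge @: T = parent_edge @: (S :\: T).
Proof.
move=> rS rT; apply/setP => f; rewrite inE; apply/andP/imsetP.
  case=> fT /imsetP[v vS Ef]; exists v => //; rewrite inE vS andbT.
  by apply: contra fT => vT; rewrite Ef imset_f.
case=> v; rewrite inE => /andP[vT vS] ->; split; last exact: imset_f.
apply: contra vT => /imsetP[u uT Ev].
have rST : r \notin S :|: T by rewrite inE negb_or rS.
by rewrite (parent_edge_inj_in rST _ _ Ev) // inE ?vS ?uT ?orbT.
Qed.

Lemma prod_reduced_dist (S : {set V}) : r \notin S ->
  \prod_(v in S) reduced_dist v v =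
  (-1) ^+ #|S| * (\prod_(f in parent_edge @: S) edge_sum a f)%:P.
Proof.
move=> rS; rewrite big_imset; last exact: parent_edge_inj_in.
rewrite rmorph_prod -prodrN; apply: eq_bigr => v vS.
by rewrite reduced_dist_diag //; apply: contraNneq rS => <-.
Qed.

Lemma det_reduced_diag (W : {set V}) n : r \in W -> #|W| = n ->
  let Eo := parent_edge @: (W :\ r) in
  \det (seq_mx r n reduced_dist (enum W) (enum W)) =
  (-1) ^+ #|Eo| *
  ((\sum_(f in Eo) edge_prod a f * \prod_(g in Eo :\ f) edge_sum a g)%:P
   + 'X * (\prod_(f in Eo) edge_sum a f)%:P).
Proof.
move=> rW nW Eo; have rWr : r \notin W :\ r by rewrite !inE eqxx.
have injE := parent_edge_inj_in rWr.
rewrite (det_arrow_seq reduced_dist_off rW) -?cardE //.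
rewrite reduced_dist_root prod_reduced_dist // card_in_imset //.
rewrite mulrDr addrC; congr (_ + _); last by rewrite mulrCA.
rewrite big_imset //= rmorph_sum mulr_sumr -sumrN; apply: eq_bigr => v vW.
have /andP[vr _] : (v != r) && (v \in W) by rewrite inE in vW; rewrite inE in vW.
rewrite reduced_dist_row // reduced_dist_col // prod_reduced_dist; last first.
  by rewrite !inE eqxx andbF.
(* The product omitting [v] has one sign fewer, which absorbs the minus sign of the arrow
   expansion. *)
rewrite (cardsD1 v (W :\ r)) vW add1n exprS mulN1r mulNr.
rewrite -(imset_set1 parent_edge v) parent_edgesD //; last first.
  by rewrite inE eq_sym.
rewrite edge_prod2 1?eq_sym ?(parent_neq treeT) // !rmorphM /=.
by rewrite mulrCA [_%:P * (a v _)%:P]mulrC.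
Qed.

Lemma det_reduced_offdiag (W : {set V}) n i0 j0 :
  r \in W -> i0 \in W -> j0 \in W -> i0 != r -> j0 != r -> i0 != j0 ->
  #|W| = n.+1 ->
  let Eo := parent_edge @: (W :\ r) in
  \det (seq_mx r n reduced_dist (enum (W :\ i0)) (enum (W :\ j0))) =
  (-1) ^+ (index i0 (enum W) + index j0 (enum W) + n) *
  (a (par i0) i0 * a j0 (par j0) *
   \prod_(f in Eo :\: [set parent_edge i0; parent_edge j0]) edge_sum a f)%:P.
Proof.
move=> rW iW jW ir jr ij nW Eo; have rWr : r \notin W :\ r by rewrite !inE eqxx.
rewrite (det_arrow_seqD1 reduced_dist_off) //.
rewrite reduced_dist_row // reduced_dist_col // prod_reduced_dist; last first.
  by rewrite !inE eqxx andbF.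
rewrite [in RHS]exprD -[RHS]mulrA; congr (_ * _).
have -> : [set parent_edge i0; parent_edge j0] = parent_edge @: [set i0; j0].
  by rewrite imsetU !imset_set1.
rewrite parent_edgesD //; last by rewrite !inE negb_or ![r == _]eq_sym ir jr.
rewrite !rmorphM /= mulrCA; congr (_ * _).
(* The diagonal product contributes [n - 2] signs, which agrees in parity with the exponent [n] of
   the claim. *)
have <- : (#|W :\ r :\: [set i0; j0]| + 2 = n)%N.
  have := cardsD1 r W; rewrite rW nW add1n => -[->].
  rewrite -(cardsID [set i0; j0] (W :\ r)) addnC; congr (_ + _)%N.
  rewrite (setIidPr _) ?cards2 ?ij // subUset !sub1set !inE.
  by rewrite ir jr iW jW.
by rewrite exprD sqrrN expr1n mulr1.
Qed.

(** Columns [u] and [v] have no diagonal entry, since neither vertex indexes a row; both can be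
    nonzero only in row [r], which no permutation can assign twice. *)
Lemma det_reduced0 n (S T : {set V}) u v : #|S| = n -> #|T| = n ->
  u != v -> u \in T -> v \in T -> u \notin S -> v \notin S -> r \in S ->
  \det (seq_mx r n reduced_dist (enum S) (enum T)) = 0.
Proof.
move=> nS nT uv uT vT uS vS rS; apply: det_no_transversal => t nz.
have row_root w : w \in T -> w \notin S ->
    exists2 k : 'I_n, nth r (enum S) k = r & nth r (enum T) (t k) = w.
  move=> wT wS.
  have lt_w : (index w (enum T) < n)%N by rewrite -nT cardE index_mem mem_enum.
  exists (t^-1%g (Ordinal lt_w)); last by rewrite permKV nth_index ?mem_enum.
  apply/eqP; move: (nz (t^-1%g (Ordinal lt_w))); rewrite mxE permKV /=.
  rewrite nth_index ?mem_enum //; apply: contraR => kr.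
  rewrite reduced_dist_off //; first by apply: contraNneq wS => ->.
  apply: contraNneq wS => <-.
  by rewrite -mem_enum mem_nth // -cardE nS.
have [k kr ku] := row_root u uT uS; have [l lr lv] := row_root v vT vS.
have Ekl : k = l.
  by apply/val_inj/eqP; rewrite /= -(nth_uniq r _ _ (enum_uniq S)) -?cardE ?nS // kr lr.
by rewrite -ku -lv Ekl eqxx in uv.
Qed.

End ReducedDistance.

(** * Minors as determinants over vertex enumerations, and the three cases *)

Lemma del_minorE (R : comNzRingType) n (M : 'M[R]_n) (I J : {set 'I_n})
    (eqIJ : #|I| = #|J|) (r : 'I_n) :
  del_minor M eqIJ = \det (seq_mx r #|~: I| M (enum (~: I)) (enum (~: J))).
Proof.
congr (\det _); apply/matrixP => i j; rewrite castmxE !mxE.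
by rewrite !(enum_val_nth r).
Qed.

Theorem theorem1p6 (R : comNzRingType) (n : nat) (e : rel 'I_n)
    (a : 'I_n -> 'I_n -> R) (I J' : {set 'I_n})
    (treeT : is_tree e)
    (eqIJ : #|I| = #|J'|) (leI : (#|I| + 3 <= n)%N)
    (propIJ : I :|: J' \proper [set: 'I_n])
    (connI : connected_on e (~: I))
    (connJ : connected_on e (~: J'))
    (connIJ : connected_on e (~: (I :&: J'))) :
  let Eo := [set f in edges e | [disjoint f & I :&: J']] in
  let M : 'M[{poly R}]_n :=
    map_mx polyC (dist_mx e a) + 'X *: const_mx 1 in
  [/\ #|symdiff I J'| = 0%N ->
        del_minor M eqIJ =
          (-1) ^+ #|Eo| *
          ((\sum_(f in Eo) edge_prod a f *
              \prod_(g in Eo :\ f) edge_sum a g)%:P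
           + 'X * (\prod_(f in Eo) edge_sum a f)%:P),
      forall i0 j0 : 'I_n,
        #|symdiff I J'| = 2%N -> I :\: J' = [set i0] -> J' :\: I = [set j0] ->
        exists p q : 'I_n,
          [/\ unique_neighbour e (~: (I :&: J')) i0 p,
              unique_neighbour e (~: (I :&: J')) j0 q &
              del_minor M eqIJ =
                (-1) ^+ #|outer_labels I J' i0 j0| *
                (a p i0 * a j0 q *
                 \prod_(f in Eo :\: [set [set p; i0]; [set j0; q]])
                    edge_sum a f)%:P] &
      (2 < #|symdiff I J'|)%N -> del_minor M eqIJ = 0].
Proof.
move=> Eo M.
(* The root is a vertex kept both as a row and as a column. *)
have [_ [r _ rNIJ]] := properP propIJ.
have [rI rJ] : r \in ~: I /\ r \in ~: J'.
  by move: rNIJ; rewrite !inE negb_or => /andP[-> ->].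
set W := ~: (I :&: J').
have rW : r \in W by rewrite /W setCI inE rI.
(* Connectedness of [W] makes it closed under parents, so the edges avoiding [I :&: J'] are the
   parent edges of its non-root vertices. *)
have EoE : Eo = parent_edge e r @: (W :\ r).
  rewrite /Eo /parent_edge -(edgesE treeT) => [|v]; last exact: parent_in.
  by apply/setP => f; rewrite !inE disjoints_subset.
have cardJ : #|~: J'| = #|~: I| := card_setC_eq eqIJ.
have minorE : del_minor M eqIJ =
    \det (seq_mx r #|~: I| (reduced_dist e a r) (enum (~: I)) (enum (~: J'))).
  rewrite (del_minorE _ _ r) -det_reduced_dist //; congr (\det _).
  by apply/matrixP => i j; rewrite !mxE mulr1.
split.
- move=> /eqP; rewrite cards_eq0 setU_eq0 !setD_eq0 -eqEsubset => /eqP EIJ.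
  have EW : ~: I = W by rewrite /W -EIJ setIid.
  by rewrite minorE -EIJ EW det_reduced_diag // EoE.
- move=> i0 j0 _ EI EJ.
  have i0W : i0 \in W.
    by have := set11 i0; rewrite -EI !inE => /andP[/negPf-> _]; rewrite andbF.
  have j0W : j0 \in W.
    by have := set11 j0; rewrite -EJ !inE => /andP[/negPf-> _].
  have CI : ~: I = W :\ i0.
    by rewrite /W -EI; apply/setP => k; rewrite !inE; case: (k \in I); case: (k \in J').
  have CJ : ~: J' = W :\ j0.
    by rewrite /W -EJ; apply/setP => k; rewrite !inE; case: (k \in I); case: (k \in J').
  have i0r : i0 != r by move: rI; rewrite CI !inE eq_sym => /andP[].
  have j0r : j0 != r by move: rJ; rewrite CJ !inE eq_sym => /andP[].
  have i0j0 : i0 != j0.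
    by have := set11 i0; rewrite -EI inE => /andP[_]; apply: contraTneq => ->;
       have := set11 j0; rewrite -EJ inE => /andP[].
  (* A neighbour of [w] in [W] other than its parent would be a child of [w]; but [W :\ w] is closed
     under parents, so it cannot contain a child of [w]. *)
  have nbr w : w \in W -> w != r -> connected_on e (W :\ w) -> r \in W :\ w ->
      unique_neighbour e W w (parent e r w).
    move=> wW wr connw rw; split; first by rewrite (edge_parent treeT) // (parent_in treeT).
    move=> v [vW ewv]; case: (edge_root treeT r ewv) => [[_ ->//]|[vr Ew]].
    have vw : v \in W :\ w.
      by rewrite inE vW andbT inE; apply: contraTneq ewv => ->; rewrite (tree_irr treeT).
    by have := parent_in treeT connw rw vw vr; rewrite -Ew !inE eqxx.
  exists (parent e r i0), (parent e r j0); split.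
  + by apply: nbr => //; rewrite -CI.
  + by apply: nbr => //; rewrite -CJ.
  have cardW : #|W| = #|~: I|.+1 by rewrite CI (cardsD1 i0 W) i0W.
  (* The dimension is abstracted so that rewriting [~: I] affects only the enumerations. *)
  rewrite minorE; move: cardW; move: #|~: I| => m cardW.
  rewrite CI CJ det_reduced_offdiag // EoE.
  rewrite [X in _ :\: [set X; _]]setUC; congr (_ * _).
  (* The cofactor sign and the signs of the diagonal combine into the exponent of [outer_parity];
     removing [i0] and [j0] from [W] leaves the complement of [I :|: J']. *)
  rewrite -signr_odd -[in RHS]signr_odd; congr ((-1) ^+ nat_of_bool _).
  have := outer_parity i0W j0W i0j0; rewrite cardW /= => ->.
  congr (odd #|pred_of_set _|); apply/setP => k; rewrite !inE; congr (_ && _).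
  move/setP/(_ k): EI; move/setP/(_ k): EJ; rewrite !inE.
  by case: (k \in I); case: (k \in J') => /= <- <-.
- move=> lt2.
  (* The two halves of the symmetric difference have equal size, so more than two elements in total
     put at least two in [I :\: J']; these index columns but no rows. *)
  have cardD : #|I :\: J'| = #|J' :\: I|.
    by apply/eqP; rewrite -(eqn_add2l #|I :&: J'|) cardsID setIC cardsID eqIJ.
  have : (1 < #|I :\: J'|)%N.
    move: lt2; rewrite /symdiff cardsU -cardD addnn.
    have -> : (I :\: J') :&: (J' :\: I) = set0.
      by apply/setP => k; rewrite !inE; case: (k \in I); case: (k \in J').
    by rewrite cards0 subn0 -[2%N]/(1.*2)%N ltn_double.
  case/card_gt1P => u [v [+ + uv]]; rewrite !inE => /andP[uJ uI] /andP[vJ vI].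
  rewrite minorE; apply: (det_reduced0 a treeT (u := u) (v := v)) => //;
    by rewrite inE ?negbK.
Qed.
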